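(* For every positive integer $n$, the sequences $P_n=(P_{n,k})_{k=0}^{n-1}$ and $Q_n=(Q_{n,k})_{k=0}^{n-1}$ are strongly synchronised, and hence each of them is log-concave.
   Context: Let $[n]=\{1,\dots,n\}$, let $\mathfrak{S}_n$ be the set of permutations of $[n]$ and $\mathcal{A}_n\subseteq\mathfrak{S}_n$ the subset of even permutations. For $\pi=\pi_1,\dots,\pi_n\in\mathfrak{S}_n$ the number of excedances is $\mathrm{exc}(\pi)=|\{i\in[n]:\pi_i>i\}|$. For $0\le k\le n-1$, $P_{n,k}$ is the number of $\pi\in\mathcal{A}_n$ with $\mathrm{exc}(\pi)=k$, and $Q_{n,k}$ is the number of $\pi\in\mathfrak{S}_n\setminus\mathcal{A}_n$ with $\mathrm{exc}(\pi)=k$. A sequence $(a_k)_{k=0}^m$ is log-concave if $a_k^2\ge a_{k-1}a_{k+1}$ for all $1\le k\le m-1$. Two non-negative sequences $(a_k)_{k=0}^m$ and $(b_k)_{k=0}^m$ are strongly synchronised if for all $1\le k\le m-1$, $$(\min\{a_k,b_k\})^2\ge \max\{a_{k+1},b_{k+1}\}\cdot\max\{a_{k-1},b_{k-1}\}.$$ *)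

(* Defs.v *)
From mathcomp Require Import all_boot all_fingroup.

Set Implicit Arguments.
Unset Strict Implicit.
Unset Printing Implicit Defensive.

(* 'I_n is {0, ..., n-1} rather than {1, ..., n}; the shift by one does not
   affect the comparison of s i with i. *)
Definition exc (n : nat) (s : 'S_n) : nat := #|[set i : 'I_n | i < s i]|.

Definition evenExc (n k : nat) : nat :=
  #|[set s : 'S_n | ~~ odd_perm s && (exc s == k)]|.

Definition oddExc (n k : nat) : nat :=
  #|[set s : 'S_n | odd_perm s && (exc s == k)]|.

(* A finite sequence (a_k) with 0 <= k <= m is represented by m together with a
   function on nat, of which only the values at 0, ..., m are used. *)
Definition log_concave (m : nat) (a : nat -> nat) : Prop :=
  forall k : nat, 1 <= k < m -> a k.-1 * a k.+1 <= a k ^ 2.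

Definition strongly_synchronised (m : nat) (a b : nat -> nat) : Prop :=
  forall k : nat, 1 <= k < m ->
    maxn (a k.+1) (b k.+1) * maxn (a k.-1) (b k.-1) <= minn (a k) (b k) ^ 2.

(* Main.v *)
Require Import Defs.
From mathcomp Require Import all_boot all_fingroup.
From mathcomp Require Import zify.

(* Every permutation of n+1 letters is tperm i max * lift t for unique t in S_n
   and i; for i = max neither the sign nor exc changes, otherwise the sign flips
   and exc grows by one unless i was already an excedance of t. Hence a recurrence
   for the numbers of even and odd permutations with k excedances, from which
   their difference is (-1)^k C(n-1, k): the smaller is the class of parity
   opposite to k (x_k) and the larger is y_k = x_k + C(n-1, k). Strong
   synchronisation reads y_(k-1) y_(k+1) <= x_k^2; it passes from n to n+1
   because the recurrence makes the new difference at least a sum of old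
   differences, a multiple of (x_k - x_(k-1))^2, a square in the gaps C, and
   monomials with nonnegative coefficients. *)

Definition excSgn (n : nat) (b : bool) (k : nat) : nat :=
  #|[set s : 'S_n | (odd_perm s == b) && (exc s == k)]|.

(** Products act left to right, so this inserts the letter [ord_max] into the cycle of [p.1] just
    after [p.2], or as a fixed point if [p.2] is [ord_max]. *)
Definition ins_max {n : nat} (p : 'S_n * 'I_n.+1) : 'S_n.+1 :=
  (tperm p.2 ord_max * lift_perm ord_max ord_max p.1)%g.

Lemma ins_max_bij n : bijective (@ins_max n).
Proof.
apply: inj_card_bij; last first.
  by rewrite card_prod !card_Sn card_ord factS mulnC.
move=> [s i] [t j]; rewrite /ins_max /= => eq_st.
have eq_ij : i = j.
  apply: (@perm_inj _ (tperm i ord_max * lift_perm ord_max ord_max s)%g).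
  rewrite [in RHS]eq_st !permM !tpermL.
  by rewrite !lift_perm_id.
move: eq_st; rewrite eq_ij => /mulgI eq_st; congr (_, _).
apply/permP => x; apply: (@lift_inj _ ord_max).
by rewrite -!(lift_perm_lift ord_max) eq_st.
Qed.

Lemma exc_le n (s : 'S_n) : exc s <= n.
Proof. by rewrite -[n in _ <= n]card_ord; apply: max_card. Qed.

Lemma excE n (s : 'S_n) : exc s = \sum_(i < n) (i < s i).
Proof. by rewrite /exc cardsE -sum1_card big_mkcond. Qed.

Lemma widen_ord_lift_max n (i : 'I_n) : widen_ord (leqnSn n) i = lift ord_max i.
Proof. by apply: val_inj; rewrite /= /bump leqNgt ltn_ord. Qed.

Lemma max_not_exc n (s : 'S_n.+1) : (n < s ord_max) = false.
Proof. by apply/negbTE; rewrite -leqNgt -ltnS ltn_ord. Qed.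

Lemma exc_ins_max n (s : 'S_n) : exc (ins_max (s, ord_max)) = exc s.
Proof.
rewrite !excE big_ord_recr /= max_not_exc addn0; apply: eq_bigr => i _.
rewrite /ins_max /= tperm1 mul1g.
by rewrite widen_ord_lift_max lift_perm_lift !lift_max.
Qed.

(** Only [i] matters: its new image is the maximum, so it becomes an excedance if it was not one. *)
Lemma exc_ins_lift n (s : 'S_n) (i : 'I_n) :
  exc (ins_max (s, lift ord_max i)) + (i < s i) = (exc s).+1.
Proof.
rewrite !excE big_ord_recr /= max_not_exc addn0.
rewrite (bigD1 i) //= [in RHS](bigD1 i) //=.
have -> : i < ins_max (s, lift ord_max i) (widen_ord (leqnSn n) i).
  by rewrite widen_ord_lift_max /ins_max /= permM tpermL lift_perm_id ltn_ord.
rewrite (eq_bigr (fun j : 'I_n => (j < s j : nat))) => [|j neq_ji].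
  by rewrite addnAC addnC add1n addnS addnC.
rewrite widen_ord_lift_max /ins_max /= permM tpermD ?lift_perm_lift ?lift_max //.
- by rewrite (inj_eq lift_inj) eq_sym.
- exact: neq_lift.
Qed.

Lemma odd_ins_max n (s : 'S_n) (i : 'I_n.+1) :
  odd_perm (ins_max (s, i)) = (i != ord_max) (+) odd_perm s.
Proof.
by rewrite /ins_max odd_permM odd_tperm odd_lift_perm addbb.
Qed.

Lemma excSgn_sum n b k :
  excSgn n b k = \sum_(s : 'S_n) ((odd_perm s == b) && (exc s == k)).
Proof. by rewrite /excSgn cardsE -sum1_card big_mkcond. Qed.

Lemma sum_non_exc n (s : 'S_n) : \sum_(i < n) ~~ (i < s i) = n - exc s.
Proof.
apply/eqP; rewrite -(eqn_add2l (exc s)) subnKC ?exc_le // {1}excE -big_split /=.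
rewrite (eq_bigr (fun=> 1)) => [|i _]; first by rewrite sum1_card card_ord.
by case: (i < s i).
Qed.

(** The terms count insertions as a fixed point, after one of [k] excedances, and after one of
    [n - k'] non-excedances. *)
Lemma excSgnS n b k :
  excSgn n.+1 b k = excSgn n b k + k * excSgn n (~~ b) k
    + if k is k'.+1 then (n - k') * excSgn n (~~ b) k' else 0.
Proof.
rewrite excSgn_sum (reindex _ (onW_bij _ (@ins_max_bij n))) /=.
rewrite -(pair_bigA _ (fun s i => nat_of_bool
   ((odd_perm (ins_max (s, i)) == b) && (exc (ins_max (s, i)) == k)))) /=.
transitivity (\sum_(s : 'S_n) (((odd_perm s == b) && (exc s == k))
   + k * ((odd_perm s == ~~ b) && (exc s == k))
   + (n - k.-1) * ((odd_perm s == ~~ b) && ((exc s).+1 == k)))).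
  apply: eq_bigr => s _; rewrite big_ord_recr /= odd_ins_max eqxx exc_ins_max.
  rewrite [LHS]addnC -addnA; congr (_ + _).
  rewrite (eq_bigr (fun i : 'I_n => (odd_perm s == ~~ b) *
     ((i < s i) * (exc s == k) + ~~ (i < s i) * ((exc s).+1 == k)))); last first.
    move=> i _; rewrite widen_ord_lift_max.
    rewrite odd_ins_max (_ : lift ord_max i != ord_max); last by rewrite eq_sym neq_lift.
    rewrite -(exc_ins_lift _ s i).
    rewrite -[exc s == k]eqSS -(exc_ins_lift _ s i).
    by case: (i < s i); case: b; case: (odd_perm s); rewrite /= ?addn0 ?addn1
      ?eqSS ?mul1n ?mul0n ?addn0 ?andbF.
  rewrite -big_distrr big_split /= -!big_distrl /= sum_non_exc -excE.
  case: (_ == ~~ b) => //=; rewrite ?mul0n ?muln0 // mul1n.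
  case: (exc s =P k) => [->|_]; first by rewrite (gtn_eqF (ltnSn k)) !muln1 !muln0.
  by case: eqP => [<-|_]; rewrite ?muln0 ?muln1.
rewrite !big_split /= -!big_distrr /= -!excSgn_sum; congr (_ + _).
(* At [k = 0] the truncated [k.-1] is harmless, since its indicator [(exc s).+1 == 0] is false. *)
case: k => [|k]; last by rewrite excSgn_sum.
by rewrite big1 ?muln0 // => s _; rewrite andbF.
Qed.

(* a, b, c, d stand for the indices k-2, ..., k+1; xi is the smaller count and ci
   the binomial gap; j = n - k for the new length n. The three equalities are
   the absorption identities of the binomials. *)
Lemma synchronised_step (xa xb xc xd ca cb cc cd k j : nat) :
  0 < k -> 1 < j ->
  (xa + ca) * (xc + cc) <= xb ^ 2 -> (xb + cb) * (xd + cd) <= xc ^ 2 ->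
  (xa + ca) * (xd + cd) <= xb * xc ->
  k * cc = j.-1 * cb -> k.-1 * cb = j * ca -> k.+1 * cd = j.-2 * cc ->
  (xb + cb + k.-1 * xb + j.+1 * (xa + ca)) *
  (xd + cd + k.+1 * xd + j.-1 * (xc + cc)) <=
  (xc + k * (xc + cc) + j * xb) ^ 2.
Proof.
case: k => [//|p] _; case: j => [|[|q]] // _ /=.
set ya := xa + ca; set yd := xd + cd => hb hc hbc rel_bc rel_ab rel_cd.
(* Doubling everything lets the equalities among the gaps trade half of each
   gap for a neighbouring one. *)
pose U1 := (2 * p + 2) * xb + (p + 2) * cb.
pose U2 := (2 * q + 2) * xc + (q + 2) * cc.
pose V := (2 * p + 4) * xc + p.+1 * cc + ((2 * q + 4) * xb + q.+1 * cb).
have e1 : 2 * (xb + cb + p * xb + q.+3 * ya) <= U1 + 2 * q.+3 * ya by rewrite /U1; nia.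
have e2 : 2 * (yd + p.+2 * xd + q.+1 * (xc + cc)) <= 2 * p.+3 * yd + U2.
  by rewrite /U2 /yd; nia.
have e3 : 2 * (xc + p.+1 * (xc + cc) + q.+2 * xb) = V by rewrite /V; nia.
(* [U1] is at most [2 * p + 2] times [xb + cb], so [hc] applies; [h2] is the mirror image. *)
have h1 : U1 * yd <= (2 * p + 2) * xc ^ 2.
  apply: leq_trans (leq_mul (leqnn _) hc); rewrite mulnA leq_mul2r; apply/orP; right.
  by rewrite /U1; nia.
have h2 : ya * U2 <= (2 * q + 2) * xb ^ 2.
  apply: leq_trans (leq_mul (leqnn _) hb); rewrite mulnCA leq_mul2l; apply/orP; right.
  by rewrite /U2; nia.
have h3 : U1 * U2 + 2 * p.+3 * ((2 * p + 2) * xc ^ 2)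
   + 2 * q.+3 * ((2 * q + 2) * xb ^ 2) + 4 * p.+3 * q.+3 * (xb * xc) <= V ^ 2.
  (* [V ^ 2] exceeds the left side by [4 (xb - xc)^2 + ((p+1) cc - (q+1) cb)^2 + S]; [g1] and [g2]
     express that these squares are nonnegative. *)
  have g1 := (nat_Cauchy xb xc).1.
  have g2 := (nat_Cauchy (p.+1 * cc) (q.+1 * cb)).1.
  pose S := (2 * p + 4) * q.+1 * (xc * cb) + (2 * q + 4) * p.+1 * (xb * cc)
    + (4 * p + 8) * p.+1 * (xc * cc) + (4 * q + 8) * q.+1 * (xb * cb)
    + (3 * p * q + 2 * p + 2 * q) * (cc * cb).
  set W := (W in W <= _).
  have : V ^ 2 + 4 * (2 * (xb * xc)) + 2 * ((p.+1 * cc) * (q.+1 * cb)) =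
    W + 4 * (xb ^ 2 + xc ^ 2) + ((p.+1 * cc) ^ 2 + (q.+1 * cb) ^ 2) + S.
    rewrite /V /W /U1 /U2 /S; lia.
  move: g1 g2; clearbody V W S; lia.
have h4 : (U1 + 2 * q.+3 * ya) * (2 * p.+3 * yd + U2) <= V ^ 2.
  apply: leq_trans h3.
  have -> : (U1 + 2 * q.+3 * ya) * (2 * p.+3 * yd + U2) =
    U1 * U2 + 2 * p.+3 * (U1 * yd) + 2 * q.+3 * (ya * U2) + 4 * p.+3 * q.+3 * (ya * yd) by lia.
  by rewrite !leq_add // leq_mul.
rewrite -(leq_pmul2l (m := 4)) // -[4]/(2 * 2) mulnACA.
apply: leq_trans (leq_mul e1 e2) _.
by rewrite -[2 * 2]/(2 ^ 2) -expnMn e3.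
Qed.

(** The product of the two inequalities gives [(ya yd)(yb yc) <= (xb xc)^2 <= (xb xc)(yb yc)]; then
    [yb yc] cancels. *)
Lemma synchronised_cross (ya xb yb xc yc yd : nat) :
  ya * yc <= xb ^ 2 -> yb * yd <= xc ^ 2 ->
  xb <= yb -> xc <= yc -> 0 < yb -> 0 < yc -> ya * yd <= xb * xc.
Proof.
move=> hb hc le_b le_c yb_gt0 yc_gt0.
have ybc_gt0 : 0 < yc * yb by rewrite muln_gt0 yc_gt0.
rewrite -(leq_pmul2r ybc_gt0) mulnACA [yd * yb]mulnC.
apply: leq_trans (leq_mul hb hc) _; rewrite -expnMn -mulnn leq_mul2l.
by apply/orP; right; rewrite mulnC leq_mul.
Qed.

Lemma excSgn0 b k : excSgn 0 b k = ~~ b && (k == 0).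
Proof.
have S0 (s : 'S_0) : s = 1%g by apply/permP => -[].
rewrite excSgn_sum (big_pred1 1%g) => [|s]; last by rewrite [s]S0 /= eqxx.
by rewrite odd_perm1 excE big_ord0; case: b; case: k.
Qed.

Lemma excSgn_gt n b k : n < k -> excSgn n.+1 b k = 0.
Proof.
move=> lt_nk; rewrite excSgn_sum big1 // => s _.
rewrite [exc s == k]ltn_eqF ?andbF //; apply: leq_ltn_trans lt_nk.
rewrite excE big_ord_recr /= max_not_exc addn0 -[leqRHS]card_ord -sum1_card.
by apply: leq_sum => i _; case: (_ < _).
Qed.

(* The smaller of the even and odd counts in S_(n+1), by excSgn_diff. *)
Definition minExc (n k : nat) : nat := excSgn n.+1 (~~ odd k) k.

(** Subtracting the recurrences for the two signs leaves [C(n,k+1) - (k+1) C(n,k+1) + (n+1-k)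
    C(n,k)], which absorption reduces to Pascal's rule. *)
Lemma excSgn_diff n k : excSgn n.+1 (odd k) k = minExc n k + 'C(n, k).
Proof.
rewrite /minExc; elim: n k => [|n IHn] [|k].
- by rewrite !excSgnS !excSgn0.
- by rewrite !excSgnS !excSgn0 !andbF !muln0.
- by rewrite !(excSgnS n.+1) !mul0n !addn0 IHn !bin0.
have := IHn k.+1; rewrite !(excSgnS n.+1) oddS !negbK IHn binS => ->.
have := mul_bin_left n k; have [le_kn|lt_nk] := leqP k n.
  by rewrite subSn //; nia.
by rewrite !bin_small //; lia.
Qed.

Lemma minExcS n k :
  minExc n.+1 k.+1 = minExc n k.+1 + k.+1 * (minExc n k.+1 + 'C(n, k.+1))
    + (n.+1 - k) * minExc n k.
Proof. by rewrite -excSgn_diff /minExc excSgnS !negbK. Qed.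

Lemma minExcS_bin n k : minExc n.+1 k.+1 + 'C(n.+1, k.+1) =
  minExc n k.+1 + 'C(n, k.+1) + k.+1 * minExc n k.+1
    + (n.+1 - k) * (minExc n k + 'C(n, k)).
Proof. by rewrite -!excSgn_diff excSgnS /minExc /= negbK. Qed.

Lemma minExc_gt n k : n < k -> minExc n k = 0.
Proof. exact: excSgn_gt. Qed.

Lemma minExc_bin_gt0 n k : (0 < minExc n k + 'C(n, k)) = (k <= n).
Proof.
have [le_kn|lt_nk] := leqP k n; first by rewrite ltn_addl // bin_gt0.
by rewrite minExc_gt // bin_small.
Qed.

Lemma minExc_synchronised n k :
  (minExc n k + 'C(n, k)) * (minExc n k.+2 + 'C(n, k.+2)) <= minExc n k.+1 ^ 2.
Proof.
elim: n k => [|n IHn] k; first by rewrite (minExc_gt 0 k.+2) // muln0.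
(* For [k >= n] the factor at [k.+2] vanishes; [k < n] keeps the larger counts at [k] and [k.+1]
   positive, as the cancellation in [synchronised_cross] requires. *)
have [lt_kn|le_nk] := ltnP k n; last first.
  by rewrite (minExc_gt n.+1 k.+2) // (@bin_small n.+1 k.+2) // muln0.
(* These are the values at index [k - 1], set to 0 when [k = 0] so that [hb] and [yb] hold there
   too. *)
pose xa := if k is k'.+1 then minExc n k' else 0.
pose ca := if k is k'.+1 then 'C(n, k') else 0.
have hb : (xa + ca) * (minExc n k.+1 + 'C(n, k.+1)) <= minExc n k ^ 2.
  by rewrite /xa /ca; case: (k) => [|k'] //; apply: IHn.
have yb : minExc n.+1 k + 'C(n.+1, k) = minExc n k + 'C(n, k)
    + k.+1.-1 * minExc n k + (n.+1 - k).+1 * (xa + ca).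
  rewrite /xa /ca; case: (k) lt_kn => [|k'] lt_kn /=.
    by rewrite -!excSgn_diff excSgnS !mul0n muln0 !addn0.
  by rewrite minExcS_bin; congr (_ + _ * _); lia.
rewrite yb minExcS_bin minExcS.
have -> : n.+1 - k.+1 = (n.+1 - k).-1 by lia.
apply: synchronised_step => //; first by lia.
- apply: (synchronised_cross _ _ _ _ _ _ hb (IHn k)); rewrite ?leq_addr //.
    by rewrite minExc_bin_gt0 ltnW.
  by rewrite minExc_bin_gt0.
- by rewrite mul_bin_left; congr (_ * _); lia.
- rewrite /ca; case: (k) => [|k'] /=; first by rewrite muln0.
  by rewrite mul_bin_left; congr (_ * _); lia.
- by rewrite mul_bin_left; congr (_ * _); lia.
Qed.

Theorem theorem5 (n : nat) (n_gt0 : 0 < n) :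
  strongly_synchronised n.-1 (evenExc n) (oddExc n) /\
  log_concave n.-1 (evenExc n) /\
  log_concave n.-1 (oddExc n).
Proof.
case: n n_gt0 => // n _ /=.
have evenE k : evenExc n.+1 k = excSgn n.+1 false k.
  by apply: eq_card => s; rewrite !inE; case: odd_perm.
have oddE k : oddExc n.+1 k = excSgn n.+1 true k.
  by apply: eq_card => s; rewrite !inE; case: odd_perm.
have maxE k : maxn (evenExc n.+1 k) (oddExc n.+1 k) = minExc n k + 'C(n, k).
  rewrite evenE oddE; have := excSgn_diff n k; rewrite /minExc.
  by case: (odd k) => /= ->; [apply/maxn_idPr|apply/maxn_idPl]; apply: leq_addr.
have minE k : minn (evenExc n.+1 k) (oddExc n.+1 k) = minExc n k.
  rewrite evenE oddE; have := excSgn_diff n k; rewrite /minExc.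
  by case: (odd k) => /= ->; [apply/minn_idPl|apply/minn_idPr]; apply: leq_addr.
have sync : strongly_synchronised n (evenExc n.+1) (oddExc n.+1).
  by case=> // k _; rewrite !maxE minE mulnC; apply: minExc_synchronised.
split=> //; split=> k /sync le_k.
  apply: leq_trans (leq_trans le_k _); last by rewrite leq_exp2r // geq_minl.
  by rewrite mulnC leq_mul // leq_maxl.
apply: leq_trans (leq_trans le_k _); last by rewrite leq_exp2r // geq_minr.
by rewrite mulnC leq_mul // leq_maxr.
Qed.
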